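(* Let $\mathcal{R}$ be a $2$-torsion free commutative domain, let $n\geq 2$, and let $\mathcal{T}_n(\mathcal{R})$ be the algebra of all $n\times n$ upper triangular matrices over $\mathcal{R}$. Let $\mathfrak{q}\colon\mathcal{T}_n(\mathcal{R})\times\mathcal{T}_n(\mathcal{R})\to\mathcal{T}_n(\mathcal{R})$ be an $\mathcal{R}$-bilinear mapping. Then every centralizing trace $\mathfrak{T}_{\mathfrak q}\colon\mathcal{T}_n(\mathcal{R})\to\mathcal{T}_n(\mathcal{R})$ of $\mathfrak{q}$ is proper; that is, if $\mathfrak{T}_{\mathfrak q}(T)=\mathfrak{q}(T,T)$ is centralizing, then it is proper.
   Context: $\mathcal{R}$ has an identity. For a unital $\mathcal{R}$-algebra $\mathcal{A}$ with center $\mathcal{Z}(\mathcal{A})$, and $[x,y]=xy-yx$: the trace of an $\mathcal{R}$-bilinear mapping $\mathfrak{q}\colon\mathcal{A}\times\mathcal{A}\to\mathcal{A}$ is $\mathfrak{T}_{\mathfrak q}(a)=\mathfrak{q}(a,a)$. It is centralizing if $[\mathfrak{T}_{\mathfrak q}(a),a]\in\mathcal{Z}(\mathcal{A})$ for all $a\in\mathcal{A}$. A centralizing trace $\mathfrak{T}_{\mathfrak q}$ is proper if $\mathfrak{T}_{\mathfrak q}(a)=za^2+\mu_1(a)a+\mu_2(a)$ for all $a\in\mathcal{A}$, where $z\in\mathcal{Z}(\mathcal{A})$, $\mu_1\colon\mathcal{A}\to\mathcal{Z}(\mathcal{A})$ is $\mathcal{R}$-linear, and $\mu_2\colon\mathcal{A}\to\mathcal{Z}(\mathcal{A})$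 is the trace of an $\mathcal{R}$-bilinear mapping $\mathcal{A}\times\mathcal{A}\to\mathcal{Z}(\mathcal{A})$. *)

(* Defs.v *)
From HB Require Import structures.
From mathcomp Require Import all_boot all_order all_algebra.

Set Implicit Arguments.
Unset Strict Implicit.
Unset Printing Implicit Defensive.

Import GRing.Theory.
Local Open Scope ring_scope.

Section Traces.
Variables (R : comNzRingType) (A : algType R).
Implicit Types (x y z a : A) (q : A -> A -> A) (f : A -> A).

Definition in_center z : Prop := forall x, GRing.comm z x.

Definition lie_bracket x y : A := x * y - y * x.

Definition trace_map q : A -> A := fun a => q a a.

Definition centralizing f : Prop :=
  forall a, in_center (lie_bracket (f a) a).

(* Maps into the center Z(A) are encoded as A-valued maps all of whose values
   are central; as Z(A) is a submodule of A, (bi)linearity over R is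
   unaffected by this. *)
Definition proper_trace f : Prop :=
  exists (z : A) (mu1 : {linear A -> A}) (mu2 : A -> A),
    [/\ in_center z,
        forall a, in_center (mu1 a),
        exists2 b : {bilinear A -> A -> A},
          forall x y, in_center (b x y) & mu2 =1 trace_map b
      & forall a, f a = z * a ^+ 2 + mu1 a * a + mu2 a].

End Traces.

(* is_trig_mx is lower triangularity, hence the transpose. *)
Definition is_utrig_mx (R : nzRingType) (n : nat) : {pred 'M[R]_n} :=
  fun M => is_trig_mx M^T.
Arguments is_utrig_mx {R n} M.

Lemma is_utrig_mxP (R : nzRingType) (n : nat) (M : 'M[R]_n) :
  reflect (forall i j : 'I_n, (j < i)%N -> M i j = 0) (M \in is_utrig_mx).
Proof.
apply: (iffP is_trig_mxP) => M0 i j lt_ij; last by rewrite mxE M0.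
by have := M0 j i lt_ij; rewrite mxE.
Qed.

Record utmx (R : nzRingType) (n : nat) : Type :=
  UTMx { utmx_val :> 'M[R]_n; _ : utmx_val \in is_utrig_mx }.

HB.instance Definition _ R n := [isSub for @utmx_val R n].
HB.instance Definition _ R n := [Choice of utmx R n by <:].

Lemma is_utrig_mx_subalg (R : comNzRingType) (n : nat) :
  GRing.subsemialg_closed (@is_utrig_mx R n.+1).
Proof.
have S1 : 1 \in @is_utrig_mx R n.+1.
  by apply/is_utrig_mxP => i j lt_ji; rewrite !mxE -val_eqE gtn_eqF.
have S0 : 0 \in @is_utrig_mx R n.+1.
  by apply/is_utrig_mxP => i j _; rewrite mxE.
have SD : {in @is_utrig_mx R n.+1 &, forall M N, M + N \in is_utrig_mx}.
  move=> M N /is_utrig_mxP M0 /is_utrig_mxP N0.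
  by apply/is_utrig_mxP => i j lt_ji; rewrite mxE M0 // N0 // addr0.
have SZ a : {in @is_utrig_mx R n.+1, forall M, a *: M \in is_utrig_mx}.
  move=> M /is_utrig_mxP M0.
  by apply/is_utrig_mxP => i j lt_ji; rewrite mxE M0 // mulr0.
have SM : {in @is_utrig_mx R n.+1 &, forall M N, M * N \in is_utrig_mx}.
  move=> M N /is_utrig_mxP M0 /is_utrig_mxP N0.
  apply/is_utrig_mxP => i j lt_ji; rewrite mxE big1 // => k _.
  have [lt_ki|le_ik] := ltnP k i; first by rewrite M0 // mul0r.
  by rewrite N0 ?mulr0 // (leq_trans lt_ji).
by do !split.
Qed.

(* MathComp algebras are nontrivial, so the size has to be positive. *)
HB.instance Definition _ (R : comNzRingType) (n : nat) :=
  GRing.SubChoice_isSubAlgebra.Build R 'M[R]_n.+1 (@is_utrig_mx R n.+1)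
    (utmx R n.+1) (@is_utrig_mx_subalg R n).

(* Main.v *)
(* Brackets of upper triangular matrices have zero diagonal, so central brackets
   vanish and T(a) = q(a, a) commutes with a.  Suppose that the leading p x p
   block of T(a) is scalar for all a.  The entries (k, p) of T(a) a = a T(a) read
     s a_kp = (a_kk - a_pp) T_kp + sum_(k < m < p) a_km T_mp,
   where s = T_00 - T_pp.  If s = 0 then column p of T vanishes off the diagonal.
   The equations for k = p-1, p-2, p-3 show in turn that the quadratic form s is
   divisible by a_(p-1,p-1) - a_pp, then also by a_(p-2,p-2) - a_pp, and that it
   is 0 (if p > 2).  For p = 1 the first quotient is a linear form
   L, and subtracting L(a) a makes s vanish.  For p = 2 the second quotient is a
   constant -z, and subtracting z (a^2 - (a_00 + a_11) a) makes s vanish without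
   disturbing the leading 2 x 2 block.

   R may be finite, so divisibility of forms is not read off values by a density
   argument: from a product of a linear and a quadratic form that vanishes
   pointwise, 2-torsion freeness and the parallelogram law still give that one
   of the factors vanishes. *)
From HB Require Import structures.
Require Import Defs.
From mathcomp Require Import all_boot all_order all_algebra.
From mathcomp Require Import ring zify.

Import GRing.Theory.
Local Open Scope ring_scope.

Set Implicit Arguments.
Unset Strict Implicit.
Unset Printing Implicit Defensive.

(** * Bilinear maps and the parallelogram law *)

Notation bilinear_map := (bilinear_for *:%R *:%R).

Lemma bilinear_map_pack (R : nzRingType) (U V : lmodType R) (B : U -> U -> V) :
  bilinear_map B -> exists B' : {bilinear U -> U -> V}, B' = B :> (U -> U -> V).
Proof.
move=> linB.
pose B' : {bilinear U -> U -> V} :=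
  HB.pack B (bilinear_isBilinear.Build _ _ _ _ _ _ _ linB).
by exists B'.
Qed.

Lemma parallelogram (R : comNzRingType) (V : lmodType R) (B : V -> V -> R^o) x y :
  bilinear_map B ->
  B (x + y) (x + y) + B (x - y) (x - y) = B x x *+ 2 + B y y *+ 2.
Proof.
move=> /bilinear_map_pack[{}B <-].
rewrite !(linearDl, linearDr, linearNl, linearNr).
by move: (B x x : R) (B x y : R) (B y x : R) (B y y : R) => b c d e; ring.
Qed.

(** * Products of a linear and a quadratic form that vanish pointwise *)

Section QuadraticForms.
Variables (R : idomainType) (V : lmodType R).
Hypothesis torsion_free2 : forall x : R, x *+ 2 = 0 -> x = 0.
Variables (W : V -> Prop).
Hypotheses (WD : forall x y, W x -> W y -> W (x + y))
  (WB : forall x y, W x -> W y -> W (x - y)).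
Variables (l : {scalar V}) (B : V -> V -> R^o).
Hypothesis linB : bilinear_map B.
Hypothesis lB0 : forall h, W h -> l h * B h h = 0.

(** If [l h = 0], then [l] is nonzero at [w] and [h ± w], so [B] vanishes there and the
    parallelogram law leaves [B h h *+ 2 = 0]. *)
Lemma linear_mul_quadratic_eq0 w :
  W w -> l w != 0 -> forall h, W h -> B h h = 0.
Proof.
move=> Ww lw0 h Wh.
have kill x : W x -> l x != 0 -> B x x = 0.
  by move=> Wx lx0; apply/(mulfI lx0); rewrite mulr0 lB0.
have [lh0|] := eqVneq (l h) 0; last exact: kill.
apply: torsion_free2; have := parallelogram h w linB.
rewrite (kill w) // (kill (h + w)) ?(kill (h - w)) //; first by rewrite mul0rn !addr0.
- exact: WB.
- by rewrite linearB lh0 sub0r oppr_eq0.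
- exact: WD.
- by rewrite linearD lh0 add0r.
Qed.

(** If [l h != 0], then [l w = 0] makes [l] nonzero at [h ± w] too; [B] vanishes at these three
    points, forcing [B w w *+ 2 = 0]. *)
Lemma quadratic_mul_linear_eq0 w :
  W w -> B w w != 0 -> forall h, W h -> l h = 0.
Proof.
move=> Ww Bw0 h Wh; have [//|lh0] := eqVneq (l h) 0.
have lw0 : l w = 0 by apply/(mulIf Bw0); rewrite mul0r lB0.
have kill x : W x -> l x = l h -> B x x = 0.
  by move=> Wx lx; apply/(mulfI lh0); rewrite mulr0 -lx lB0.
case/eqP: Bw0; apply: torsion_free2; have := parallelogram h w linB.
rewrite (kill h) // (kill (h + w)) ?(kill (h - w)) //; first by rewrite mul0rn addr0 add0r.
- exact: WB.
- by rewrite linearB lw0 subr0.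
- exact: WD.
- by rewrite linearD lw0 addr0.
Qed.

End QuadraticForms.

(** * Divisibility by a linear form with a normalized vector *)

Section HyperplaneFactor.
Variables (R : comNzRingType) (V : lmodType R).
Variables (l : {scalar V}) (e : V).
Hypothesis le1 : l e = 1.

Lemma in_hyperplane a : l (a - l a *: e) = 0.
Proof. by rewrite linearB linearZ /= le1 mulr1 subrr. Qed.

Lemma linear_hyperplane_factor (f : {scalar V}) :
  (forall h, l h = 0 -> f h = 0) -> forall a, f a = f e * l a.
Proof.
move=> f0 a; have /eqP := f0 _ (in_hyperplane a).
by rewrite linearB linearZ subr_eq0 => /eqP->; rewrite mulrC.
Qed.

(** Expanding [B] at [a - l a *: e], which lies in the kernel of [l], exhibits the cofactor
    [B a e + B e a - l a * B e e]. *)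
Lemma quadratic_hyperplane_factor (B : V -> V -> R^o) :
  bilinear_map B -> (forall h, l h = 0 -> B h h = 0) ->
  exists f : {scalar V}, forall a, B a a = l a * f a.
Proof.
move=> /bilinear_map_pack[{}B <-] B0.
have linf : linear_for *%R (fun a => B a e + B e a - l a * B e e).
  move=> c x y; rewrite linearPl linearPr linearP /=.
  by rewrite /GRing.scale /=; ring.
pose f : {scalar V} := HB.pack (fun a => B a e + B e a - l a * B e e)
  (GRing.isLinear.Build _ _ _ _ _ linf).
exists f => a; have := B0 _ (in_hyperplane a).
rewrite !(linearDl, linearDr, linearNl, linearNr, linearZl_LR, linearZr_LR).
rewrite /GRing.scale /= => /eqP; rewrite -subr_eq0 => B0'.
by apply/eqP; rewrite -subr_eq0 -(eqP B0') -subr_eq0; apply/eqP; rewrite /f /=; ring.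
Qed.

End HyperplaneFactor.

Lemma bilinear_form_comp (R : nzRingType) (U V : lmodType R) (B : U -> U -> V)
    (f : {scalar V}) :
  bilinear_map B -> bilinear_map (fun x y => f (B x y) : R^o).
Proof.
move=> [linl linr]; split=> x c y z.
  by rewrite (linl x) linearP.
by rewrite (linr x) linearP.
Qed.

Lemma bilinear_mapB (R : nzRingType) (U V : lmodType R) (B C : U -> U -> V) :
  bilinear_map B -> bilinear_map C -> bilinear_map (fun x y => B x y - C x y).
Proof.
move=> [Bl Br] [Cl Cr]; split=> x c y z /=.
  by rewrite (Bl x) (Cl x) scalerBr opprD addrACA.
by rewrite (Br x) (Cr x) scalerBr opprD addrACA.
Qed.

Lemma bilinear_scale (R : comNzRingType) (V : lmodType R) (f : {scalar V}) :
  bilinear_map (fun x y : V => f x *: y).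
Proof.
split=> x c y z.
  by rewrite linearP /= scalerDl scalerA.
by rewrite /= scalerDr !scalerA mulrC.
Qed.

Lemma bilinear_mul_linear (R : comNzRingType) (V : lmodType R) (f g : {scalar V}) :
  bilinear_map (fun x y => f x * g y : R^o).
Proof.
by split=> x c y z; rewrite linearP /= /GRing.scale /=; ring.
Qed.

(** * Entries and matrix units *)

Section UpperTriangular.
Variables (R : idomainType) (n : nat).
Hypothesis torsion_free2 : forall x : R, x *+ 2 = 0 -> x = 0.
Local Notation A := (utmx R n.+1).
Implicit Types (a b : A) (i j k m p : 'I_n.+1) (q : A -> A -> A).

Definition entry i j a : R := utmx_val a i j.

Lemma entry_is_linear i j : scalar (entry i j).
Proof. by move=> c a b; rewrite /entry !mxE. Qed.

HB.instance Definition _ i j :=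
  GRing.isLinear.Build R A R *%R (entry i j) (@entry_is_linear i j).

Lemma entry_lower i j a : (j < i)%N -> entry i j a = 0.
Proof. by move=> lt_ji; have /is_utrig_mxP := valP a; apply. Qed.

Lemma entryM i j a b : entry i j (a * b) = \sum_k entry i k a * entry k j b.
Proof. by rewrite /entry !mxE. Qed.

Lemma entry1 i j : entry i j 1 = (i == j)%:R.
Proof. by rewrite /entry !mxE. Qed.

Lemma entry_inj a b : (forall i j, entry i j a = entry i j b) -> a = b.
Proof. by move=> eq_ab; apply/val_inj/matrixP. Qed.

Lemma entry_diagM i a b : entry i i (a * b) = entry i i a * entry i i b.
Proof.
rewrite entryM (bigD1 i) //= big1 ?addr0 // => k neq_ki.
have [lt_ki|lt_ik|/val_inj eq_ki] := ltngtP k i.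
- by rewrite (@entry_lower i k) ?mul0r.
- by rewrite (@entry_lower k i) ?mulr0.
- by rewrite eq_ki eqxx in neq_ki.
Qed.

(** The default 0 is taken when [j < i], where the matrix unit is not upper triangular. *)
Definition ut_delta i j : A := insubd 0 (delta_mx i j).

Lemma entry_ut_delta i j k m : (i <= j)%N ->
  entry k m (ut_delta i j) = ((k == i) && (m == j))%:R.
Proof.
move=> le_ij; rewrite /entry (_ : utmx_val _ = delta_mx i j) ?mxE //.
apply: insubdK; apply/is_utrig_mxP => i' j' lt_ji; rewrite mxE.
by case: andP => // -[/eqP eqi /eqP eqj]; rewrite eqi eqj ltnNge le_ij in lt_ji.
Qed.

Definition diag_diff i j : {scalar A} := entry i i \- entry j j.

Lemma diag_diffE i j a : diag_diff i j a = entry i i a - entry j j a.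
Proof. by []. Qed.

(** * Column equations and the diagonal difference s *)

Definition commuting q := forall a, q a a * a = a * q a a.

Definition leading_scalar (r : nat) q := forall a i j,
  (i < r)%N -> (j < r)%N -> entry i j (q a a) = entry 0 0 (q a a) *+ (i == j).

Lemma leading_scalar1 q : leading_scalar 1 q.
Proof.
move=> a i j; rewrite !ltnS !leqn0 => /eqP i0 /eqP j0.
have -> : i = 0 by apply/val_inj.
by have -> : j = 0 by apply/val_inj.
Qed.

(** In row k of T(a) a only T_kk and T_kp contribute: the block is scalar, and a_mp = 0 for m > p.
    In a T(a), triangularity leaves k <= m <= p. *)
Lemma column_eq q p k a : commuting q -> leading_scalar p q -> (k < p)%N ->
  diag_diff 0 p (q a a) * entry k p a =
  diag_diff k p a * entry k p (q a a)
  + \sum_(m : 'I_n.+1 | (k < m < p)%N) entry k m a * entry m p (q a a).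
Proof.
move=> comm_q lead_q lt_kp; have := congr1 (entry k p) (comm_q a).
have neq_pk : p != k by rewrite -val_eqE gtn_eqF.
rewrite !entryM (bigD1 k) // (bigD1 p) //= big1 => [|m /andP[neq_mk neq_mp]].
  rewrite [in X in _ = X -> _](bigD1 k) // [in X in _ = X -> _](bigD1 p) //=.
  rewrite (_ : \sum_(i | (i != k) && (i != p)) _ =
    \sum_(m : 'I_n.+1 | (k < m < p)%N) entry k m a * entry m p (q a a)).
    rewrite (lead_q a k k) // eqxx mulr1n addr0.
    move: (\sum_(_ | _) _) => S eqS.
    rewrite -[S](addKr (entry k p a * entry p p (q a a))).
    rewrite -[_ + S](addKr (entry k k a * entry k p (q a a))) -eqS; ring.
  rewrite [RHS]big_mkcond [LHS]big_mkcond /=; apply: eq_bigr => m _.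
  rewrite -!val_eqE /=; have [lt_mk|lt_km|//] := ltngtP m k.
    by rewrite (@entry_lower k m) // mul0r if_same.
  have [//|lt_pm|//] := ltngtP m p.
  by rewrite (@entry_lower m p) // mulr0.
have [lt_mp|lt_pm|/val_inj eq_mp] := ltngtP m p.
- by rewrite (lead_q a k m) // eq_sym (negPf neq_mk) mul0r.
- by rewrite (@entry_lower m p) // mulr0.
- by rewrite eq_mp eqxx in neq_mp.
Qed.

(** For m = p-1 the sum in the column equation is empty, so s a_mp = 0 on the hyperplane a_mm =
    a_pp. As a_mp is not identically 0 there, s vanishes on it. *)
Lemma diag_diff_factor q p m : bilinear_map q -> commuting q ->
  leading_scalar p q -> m.+1 = p :> nat ->
  exists L : {scalar A},
    forall a, diag_diff 0 p (q a a) = diag_diff m p a * L a.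
Proof.
move=> lin_q comm_q lead_q def_p.
have lt_mp : (m < p)%N by rewrite -def_p.
have le_mp := ltnW lt_mp; have neq_mp : m != p by rewrite -val_eqE ltn_eqF.
have lin_s := bilinear_form_comp (diag_diff 0 p) lin_q.
apply: (@quadratic_hyperplane_factor _ _ (diag_diff m p) (ut_delta m m) _ _ lin_s).
  by rewrite diag_diffE !entry_ut_delta // !eqxx eq_sym (negPf neq_mp) subr0.
apply: (@linear_mul_quadratic_eq0 _ _ torsion_free2
  (fun h => diag_diff m p h = 0) _ _ (entry m p) _ lin_s _ (ut_delta m p)).
- by move=> x y x0 y0; rewrite linearD x0 y0 addr0.
- by move=> x y x0 y0; rewrite linearB x0 y0 subr0.
- move=> h h0; rewrite mulrC (column_eq h comm_q lead_q lt_mp) h0 mul0r add0r.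
  by rewrite big1 // => i; rewrite -def_p ltnS ltnNge => /andP[/negP].
- by rewrite diag_diffE !entry_ut_delta // eqxx [p == m]eq_sym (negPf neq_mp) subrr.
- by rewrite /= entry_ut_delta // !eqxx oner_eq0.
Qed.

Lemma leading_scalarS q p : bilinear_map q -> commuting q ->
  leading_scalar p q -> (forall a, diag_diff 0 p (q a a) = 0) ->
  leading_scalar p.+1 q.
Proof.
move=> lin_q comm_q lead_q diag0.
(* Going up column p, the entries below row k are already 0, which leaves (a_kk - a_pp) T_kp = 0. *)
have col0 d k : (p - k <= d)%N -> (k < p)%N -> forall a, entry k p (q a a) = 0.
  elim: d k => [|d IHd] k; first by rewrite leqn0 subn_eq0 leqNgt => /negPf->.
  move=> le_pk lt_kp a; have neq_kp : k != p by rewrite -val_eqE ltn_eqF.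
  apply: (@linear_mul_quadratic_eq0 _ _ torsion_free2 (fun=> True) _ _
    (diag_diff k p) _ (bilinear_form_comp (entry k p) lin_q) _ (ut_delta k k)) => //.
  - move=> b _; have := column_eq b comm_q lead_q lt_kp.
    rewrite diag0 mul0r big1 ?addr0 // => m /andP[lt_km lt_mp].
    rewrite IHd ?mulr0 //; lia.
  - by rewrite diag_diffE !entry_ut_delta // eqxx [p == k]eq_sym (negPf neq_kp) subr0 oner_eq0.
move=> a i j; rewrite !ltnS => le_ip le_jp.
have [->|neq_ip] := eqVneq i p; have [->|neq_jp] := eqVneq j p.
- by apply/esym/eqP; rewrite -subr_eq0 -diag_diffE diag0.
- rewrite entry_lower // ltn_neqAle le_jp andbT.
  by rewrite val_eqE.
- by rewrite (negPf neq_ip); apply: (col0 p); rewrite ?leq_subr // ltn_neqAle le_ip andbT val_eqE.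
- by apply: lead_q; rewrite ltn_neqAle ?le_ip ?le_jp andbT val_eqE.
Qed.

Lemma diag_diff_factor2 q p m k : bilinear_map q -> commuting q ->
  leading_scalar p q -> m.+1 = p :> nat -> k.+1 = m :> nat ->
  exists z : R, forall a,
    diag_diff 0 p (q a a) = z * (diag_diff k p a * diag_diff m p a).
Proof.
move=> lin_q comm_q lead_q def_p def_m.
have [L def_s] := diag_diff_factor lin_q comm_q lead_q def_p.
have lt_mp : (m < p)%N by rewrite -def_p.
have lt_km : (k < m)%N by rewrite -def_m.
have lt_kp := ltn_trans lt_km lt_mp.
have neq_mp : m != p by rewrite -val_eqE ltn_eqF.
have neq_kp : k != p by rewrite -val_eqE ltn_eqF.
have neq_km : k != m by rewrite -val_eqE ltn_eqF.
have lin_v : bilinear_map (fun a b => entry m p (q a b) - L a * entry m p b : R^o).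
  exact: (bilinear_mapB (bilinear_form_comp _ lin_q) (bilinear_mul_linear _ _)).
(* The equation in row m is multiplied by a_mm - a_pp on both sides; this factor is cancelled as a
   form, not pointwise. *)
have def_v a : entry m p (q a a) = L a * entry m p a.
  apply/eqP; rewrite -subr_eq0; apply/eqP.
  apply: (@linear_mul_quadratic_eq0 _ _ torsion_free2 (fun=> True) _ _
    (diag_diff m p) _ lin_v _ (ut_delta m m)) => // [b _|].
    have := column_eq b comm_q lead_q lt_mp; rewrite big1 ?addr0 => [|i].
      by rewrite mulrBr => <-; rewrite def_s; ring.
    by rewrite -def_p ltnS ltnNge => /andP[/negP].
  by rewrite diag_diffE !entry_ut_delta // eqxx [p == m]eq_sym (negPf neq_mp) subr0 oner_eq0.
have lin_g := bilinear_mapB (bilinear_mul_linear (diag_diff m p) (entry k p))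
  (bilinear_mul_linear (entry k m) (entry m p)).
(* On a_kk = a_pp, row k reads L(a) ((a_mm - a_pp) a_kp - a_km a_mp) = 0, and the quadratic factor
   is 1 at E_kp + E_mm. *)
have L0 h : diag_diff k p h = 0 -> L h = 0.
  apply: (@quadratic_mul_linear_eq0 _ _ torsion_free2
    (fun h => diag_diff k p h = 0) _ _ L _ lin_g _ (ut_delta k p + ut_delta m m)).
  - by move=> x y x0 y0; rewrite linearD x0 y0 addr0.
  - by move=> x y x0 y0; rewrite linearB x0 y0 subr0.
  - move=> x x0; have := column_eq x comm_q lead_q lt_kp.
    rewrite x0 mul0r add0r def_s (big_pred1 m) => [|i]; last first.
      by rewrite /= -val_eqE /=; lia.
    rewrite def_v => /eqP; rewrite -subr_eq0 => /eqP eq0; rewrite -[RHS]eq0; ring.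
  - rewrite diag_diffE !linearD /= !entry_ut_delta // ?(ltnW lt_kp) //.
    by rewrite !eqxx ![p == _]eq_sym (negPf neq_kp) (negPf neq_km) (negPf neq_mp) !addr0 subrr.
  - rewrite diag_diffE !linearD /= !entry_ut_delta // ?(ltnW lt_kp) //.
    rewrite !eqxx ![p == _]eq_sym ![m == k]eq_sym (negPf neq_kp) (negPf neq_km) (negPf neq_mp) /=.
    by rewrite !(add0r, addr0, subr0, mul1r, mulr0, mul0r) oner_eq0.
exists (L (ut_delta k k)) => a; rewrite def_s.
rewrite (@linear_hyperplane_factor _ _ (diag_diff k p) (ut_delta k k) _ L L0 a); first by ring.
by rewrite diag_diffE !entry_ut_delta // eqxx [p == k]eq_sym (negPf neq_kp) subr0.
Qed.

Lemma diag_diff_eq0 q p : bilinear_map q -> commuting q ->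
  leading_scalar p q -> (2 < p)%N -> forall a, diag_diff 0 p (q a a) = 0.
Proof.
move=> lin_q comm_q lead_q lt2p.
have ltp := ltn_ord p.
pose m : 'I_n.+1 := inord p.-1; pose k : 'I_n.+1 := inord p.-2.
pose j : 'I_n.+1 := inord p.-2.-1.
have mE : m = p.-1 :> nat by rewrite inordK //; lia.
have kE : k = p.-2 :> nat by rewrite inordK //; lia.
have jE : j = p.-2.-1 :> nat by rewrite inordK //; lia.
have [z def_s] : exists z : R, forall a,
    diag_diff 0 p (q a a) = z * (diag_diff k p a * diag_diff m p a).
  by apply: diag_diff_factor2 => //; lia.
have lt_jp : (j < p)%N by lia.
have [pm pk pj] : [/\ p == m = false, p == k = false & p == j = false].
  by rewrite -!val_eqE /=; split; lia.
have [mk mj kj] : [/\ m == k = false, m == j = false & k == j = false].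
  by rewrite -!val_eqE /=; split; lia.
suff z0 : z = 0 by move=> a; rewrite def_s z0 mul0r.
(* At this matrix s = z and a_jp = 1, while a_jj = a_pp and a_ji = 0 for j < i < p, so row j reads z
   = 0. *)
have := column_eq (ut_delta k k + ut_delta m m + ut_delta j p) comm_q lead_q lt_jp.
rewrite def_s big1 => [|i /andP[lt_ji lt_ip]].
  rewrite !diag_diffE !linearD /= !entry_ut_delta ?(ltnW lt_jp) //.
  rewrite !eqxx !pm !pk !pj !mk ![k == m]eq_sym !mk ![j == _]eq_sym !mj !kj pj /=.
  rewrite ?mj ?kj ?andbF /= !(add0r, addr0, subr0, mul1r, mulr1, mulr0, mul0r).
  by rewrite oppr0 mul0r.
rewrite !(linearD (entry j i)) /= !entry_ut_delta ?(ltnW lt_jp) //.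
rewrite ![j == _]eq_sym mj kj eqxx !add0r.
by rewrite -[i == p]val_eqE ltn_eqF //= mul0r.
Qed.

(** * Reduction to a scalar-valued trace *)

Definition subtract_proper q (z : R) (L : {scalar A}) : A -> A -> A :=
  fun a b => q a b - L a *: b - z *: (a * b).

Lemma bilinear_subtract_proper q z L :
  bilinear_map q -> bilinear_map (subtract_proper q z L).
Proof.
move=> lin_q; apply: bilinear_mapB.
  exact: bilinear_mapB lin_q (bilinear_scale L).
split=> x c a b /=.
  by rewrite /= mulrDl -scalerAl scalerDr !scalerA mulrC.
by rewrite /= mulrDr -scalerAr scalerDr !scalerA mulrC.
Qed.

Lemma commuting_subtract_proper q z L :
  commuting q -> commuting (subtract_proper q z L).
Proof.
move=> comm_q a; rewrite /subtract_proper !(mulrBl, mulrBr) comm_q.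
by rewrite -!scalerAl -!scalerAr mulrA.
Qed.

(** The diagonal of a^2 consists of the squares a_ii^2, and a_ii^2 - a_jj^2 factors. *)
Lemma diag_diff_subtract_proper q z L i j a :
  diag_diff i j (subtract_proper q z L a a) = diag_diff i j (q a a)
    - diag_diff i j a * (L a + z * (entry i i a + entry j j a)).
Proof.
rewrite /subtract_proper !linearB !linearZ /= !entry_diagM; ring.
Qed.

Lemma leading_scalar_linear q : bilinear_map q -> commuting q -> (0 < n)%N ->
  exists L : {scalar A}, leading_scalar 2 (subtract_proper q 0 L).
Proof.
move=> lin_q comm_q n_gt0; pose p : 'I_n.+1 := inord 1.
have pE : p = 1%N :> nat by rewrite inordK.
have lead1 q' : leading_scalar p q' by rewrite pE; apply: leading_scalar1.
have [L def_s] : exists L : {scalar A},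
    forall a, diag_diff 0 p (q a a) = diag_diff 0 p a * L a.
  exact: diag_diff_factor.
exists L; rewrite -pE; apply: leading_scalarS => //.
- exact: bilinear_subtract_proper.
- exact: commuting_subtract_proper.
- by move=> a; rewrite diag_diff_subtract_proper def_s mul0r addr0 subrr.
Qed.

Lemma leading_scalar_quadratic q : bilinear_map q -> commuting q -> (1 < n)%N ->
  leading_scalar 2 q ->
  exists z L, leading_scalar 3 (subtract_proper q z L).
Proof.
move=> lin_q comm_q n_gt1 lead2.
pose m : 'I_n.+1 := inord 1; pose p : 'I_n.+1 := inord 2.
have mE : m = 1%N :> nat by rewrite inordK // ltnW.
have pE : p = 2%N :> nat by rewrite inordK.
have [z def_s] : exists z, forall a,
    diag_diff 0 p (q a a) = z * (diag_diff 0 p a * diag_diff m p a).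
  by apply: diag_diff_factor2; rewrite ?mE ?pE.
(* Together with the coefficient [- z] of a^2, this form changes the difference of entries 0 and m
   by 0, and that of entries 0 and p by exactly the product in [def_s]. *)
have lin_L : scalar (fun a : A => z * (entry 0 0 a + entry m m a)).
  by move=> c a b; rewrite !linearP /=; ring.
pose L : {scalar A} := HB.pack (fun a : A => z * (entry 0 0 a + entry m m a))
  (GRing.isLinear.Build _ _ _ _ _ lin_L).
have LE a : L a = z * (entry 0 0 a + entry m m a) by [].
exists (- z), L.
have lin_q' := bilinear_subtract_proper (- z) L lin_q.
have comm_q' := @commuting_subtract_proper q (- z) L comm_q.
have lead2' : leading_scalar p (subtract_proper q (- z) L).
  (* Only the diagonal needs checking: commutation recovers the off-diagonal entry. *)
  rewrite pE -mE; apply: leading_scalarS => // [|a].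
    by rewrite mE; apply: leading_scalar1.
  rewrite diag_diff_subtract_proper LE [diag_diff 0 m (q a a)]diag_diffE.
  by rewrite (lead2 a m m) ?mE // eqxx subrr; ring.
rewrite -pE; apply: leading_scalarS => // a.
by rewrite diag_diff_subtract_proper LE def_s !diag_diffE; ring.
Qed.

Lemma leading_scalar_all q : bilinear_map q -> commuting q ->
  leading_scalar 3 q -> leading_scalar n.+1 q.
Proof.
move=> lin_q comm_q lead3.
have lead r : (r <= n.+1)%N -> leading_scalar r q.
  elim: r => [//|r IHr lt_rn]; have [lt_r3|le_3r] := ltnP r 3.
    by move=> a i j lt_ir lt_jr; apply: lead3; lia.
  pose p := Ordinal lt_rn; rewrite -[r]/(nat_of_ord p).
  have lead_p : leading_scalar p q by apply: IHr; apply: ltnW.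
  by apply: leading_scalarS => //; apply: diag_diff_eq0.
exact: lead.
Qed.

Lemma commuting_proper q : bilinear_map q -> commuting q -> (0 < n)%N ->
  exists z L, leading_scalar n.+1 (subtract_proper q z L).
Proof.
move=> lin_q comm_q n_gt0.
have [L1 lead2] := leading_scalar_linear lin_q comm_q n_gt0.
(* For size 2 the leading 2 x 2 block is the whole matrix. *)
have [le_n1|n_gt1] := leqP n 1.
  by exists 0, L1 => a i j lt_i lt_j; apply: lead2; lia.
have lin1 := bilinear_subtract_proper 0 L1 lin_q.
have comm1 := @commuting_subtract_proper q 0 L1 comm_q.
have [z [L2 lead3]] := leading_scalar_quadratic lin1 comm1 n_gt1 lead2.
exists z, (L1 \+ L2 : {scalar A}) => a i j lt_i lt_j.
have := leading_scalar_all (bilinear_subtract_proper z L2 lin1)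
  (@commuting_subtract_proper _ z L2 comm1) lead3 a lt_i lt_j.
by rewrite /subtract_proper scale0r subr0 -[_ - L1 a *: a - _]addrA -opprD -scalerDl.
Qed.

(** * Central elements and centralizing traces *)

Lemma in_center_scalar (c : R) : in_center (c *: 1 : A).
Proof. by move=> a; rewrite /GRing.comm -scalerAl -scalerAr mul1r mulr1. Qed.

(** Commuting with E_jj kills the entries (i, j), i < j, of the central bracket; its diagonal is 0
    because [R] is commutative. *)
Lemma centralizing_commuting q : centralizing (trace_map q) -> commuting q.
Proof.
move=> cent_q a; apply/eqP; rewrite -subr_eq0; apply/eqP/entry_inj => i j.
rewrite [RHS]linear0; have [lt_ij|lt_ji|/val_inj->] := ltngtP i j.
- have := congr1 (entry i j) (cent_q a (ut_delta j j)).
  rewrite !entryM (bigD1 j) //= big1 => [|k neq_kj]; last first.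
    by rewrite entry_ut_delta // (negPf neq_kj) mulr0.
  rewrite [in X in _ = X -> _]big1 => [|k _]; last first.
    by rewrite entry_ut_delta // -val_eqE ltn_eqF // mul0r.
  by rewrite entry_ut_delta // !eqxx mulr1 addr0.
- exact: entry_lower.
- by rewrite linearB /= !entry_diagM mulrC subrr.
Qed.

End UpperTriangular.

Unset Implicit Arguments.

(* n.+2 ranges over all matrix sizes >= 2. *)
Theorem corollary3p12 (R : idomainType)
  (torsion_free2 : forall x : R, x *+ 2 = 0 -> x = 0) (n : nat)
  (q : {bilinear utmx R n.+2 -> utmx R n.+2 -> utmx R n.+2}) :
  centralizing (trace_map q) -> proper_trace (trace_map q).
Proof.
move=> /centralizing_commuting comm_q; pose A := utmx R n.+2.
have lin_q : bilinear_map (q : A -> A -> A).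
  by split=> x c a b; rewrite ?linearPr // linearPl.
have [z [L lead]] := commuting_proper torsion_free2 lin_q comm_q isT.
pose q' : A -> A -> A := subtract_proper q z L.
have lin_q' : bilinear_map q' := bilinear_subtract_proper z L lin_q.
have lin_mu : linear (fun a : A => L a *: (1 : A)).
  by move=> c a b; rewrite linearP scalerDl scalerA.
pose mu1 : {linear A -> A} := HB.pack (fun a : A => L a *: (1 : A))
  (GRing.isLinear.Build _ _ _ _ _ lin_mu).
(* Only the values q'(a, a) are known to be scalar. Keeping the (0, 0) entry makes every value
   central without changing the trace. *)
pose beta (a b : A) : A := entry 0 0 (q' a b) *: 1.
have lin_beta : bilinear_map beta.
  split=> x c a b; rewrite /beta.
    by rewrite (lin_q'.1 x) linearP /= scalerDl scalerA.
  by rewrite (lin_q'.2 x) linearP /= scalerDl scalerA.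
have [b def_b] := bilinear_map_pack lin_beta.
exists (z *: 1), mu1, (trace_map b); split.
- exact: in_center_scalar.
- by move=> a; apply: in_center_scalar.
- by exists b => // x y; rewrite def_b; apply: in_center_scalar.
move=> a; have -> : trace_map b a = q' a a.
  rewrite /trace_map def_b.
  apply: entry_inj => i j; rewrite lead // linearZ /= entry1.
  by rewrite mulr_natr.
rewrite /trace_map /q' /subtract_proper /= -!scalerAl !mul1r expr2.
by rewrite [RHS]addrC addrA !subrK.
Qed.
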